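(* Let $M$ be a smooth manifold. For every twisted Poisson structure $(\pi,\phi)$ on $M$, the bivector field $\pi$ is foliated.
   Context: For a bivector field $\pi$ on $M$, $\pi^\#:T^*M\to TM$ is defined by $\langle \pi^\#(\xi),\eta\rangle=\langle \pi,\xi\wedge\eta\rangle$, and $\wedge^3\pi^\#:\wedge^3T^*M\to\wedge^3TM$ is the induced map. A twisted Poisson structure on $M$ is a pair $(\pi,\phi)$ with $\pi$ a bivector field and $\phi$ a $3$-form such that $\frac12[\pi,\pi]=\wedge^3\pi^\#(\phi)$ (Schouten–Nijenhuis bracket) and $d\phi=0$. A bivector field $\pi$ is foliated if $\pi^\#(\Omega^1(M))$ is an integrable distribution, i.e. $[\pi^\#(\Omega^1(M)),\pi^\#(\Omega^1(M))]\subset\pi^\#(\Omega^1(M))$. *)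

(* Defs.v *)
(* MathComp / MathComp-Analysis, over an arbitrary [R : realType]. *)
From HB Require Import structures.
From mathcomp Require Import all_boot all_order all_algebra all_fingroup.
From mathcomp Require Import all_classical all_reals all_analysis.

Set Implicit Arguments.
Unset Strict Implicit.
Unset Printing Implicit Defensive.

Import Order.TTheory GRing.Theory Num.Theory.
Import numFieldNormedType.Exports.

Local Open Scope classical_set_scope.
Local Open Scope ring_scope.

Definition pderive (R : realType) (n : nat) (i : 'I_n) (f : 'rV[R]_n -> R)
  : 'rV[R]_n -> R := fun u => 'D_(delta_mx 0 i) f u.

(* [f] is only looked at on the set [U], always an open set below. *)
Fixpoint Ck (R : realType) (n : nat) (k : nat) (U : set 'rV[R]_n)
    (f : 'rV[R]_n -> R) : Prop :=
  (forall u, U u -> {for u, continuous f}) /\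
  (if k is k'.+1 then
     forall i : 'I_n,
       (forall u, U u -> derivable f u (delta_mx 0 i)) /\
       Ck k' U (pderive i f)
   else True).

Definition smooth_on (R : realType) (n : nat) (U : set 'rV[R]_n)
    (f : 'rV[R]_n -> R) : Prop := forall k, Ck k U f.

(* A homeomorphism from the open set [cdom] of [M] onto an open set of [R^n].
   [cmap] and [cinv] are total functions; their values outside [cdom] and
   [cmap @` cdom] are junk. *)
Record chart (R : realType) (n : nat) (M : topologicalType) := Chart {
  cdom : set M;
  cmap : M -> 'rV[R]_n;
  cinv : 'rV[R]_n -> M;
  cdom_open : open cdom;
  ccod_open : open (cmap @` cdom);
  cmapK : forall p, cdom p -> cinv (cmap p) = p;
  cmap_continuous : forall p, cdom p -> {for p, continuous cmap};
  cinv_continuous : forall u, (cmap @` cdom) u -> {for u, continuous cinv}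
}.

Definition ccod (R : realType) (n : nat) (M : topologicalType)
  (c : chart R n M) : set 'rV[R]_n := cmap c @` cdom c.

Definition transition (R : realType) (n : nat) (M : topologicalType)
  (c c' : chart R n M) : 'rV[R]_n -> 'rV[R]_n := fun u => cmap c' (cinv c u).

Definition transition_dom (R : realType) (n : nat) (M : topologicalType)
  (c c' : chart R n M) : set 'rV[R]_n :=
  [set u | ccod c u /\ cdom c' (cinv c u)].

(* The smooth structure is given by an arbitrary smooth atlas. *)
Record smooth_manifold (R : realType) (n : nat) := SmoothManifold {
  points :> topologicalType;
  points_hausdorff : hausdorff_space points;
  points_second_countable : @second_countable points;
  chart_index : Type;
  charts : chart_index -> chart R n points;
  charts_cover : forall p : points, exists c, cdom (charts c) p;
  charts_compatible : forall (c c' : chart_index) (i : 'I_n),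
    smooth_on (transition_dom (charts c) (charts c'))
              (fun u => transition (charts c) (charts c') u 0 i)
}.

Section Tensors.
Context (R : realType) (n : nat) (M : smooth_manifold R n).

Local Notation dom c := (ccod (charts (s := M) c)).
Local Notation tr c c' := (transition (charts (s := M) c) (charts c')).
Local Notation tr_dom c c' := (transition_dom (charts (s := M) c) (charts c')).

(* Components of a tensor field with [k] indices: [T c u I] is the component
   of multi-index [I] in the chart [c], at the point of coordinates [u]; it is
   meaningful for [u] in [ccod (charts c)] only, and fields are compared there
   ([field_eq]). *)
Definition components (k : nat) : Type :=
  chart_index M -> 'rV[R]_n -> k.-tuple 'I_n -> R.

Definition field_eq (k : nat) (S T : components k) : Prop :=
  forall c u, dom c u -> forall I, S c u I = T c u I.

Definition smooth_components (k : nat) (T : components k) : Prop :=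
  forall c I, smooth_on (dom c) (fun u => T c u I).

Definition alternating (k : nat) (T : components k) : Prop :=
  forall c u, dom c u -> forall (s : 'S_k) (I : k.-tuple 'I_n),
    T c u [tuple tnth I (s a) | a < k] = (-1) ^+ s * T c u I.

(* The Jacobian entry d(tr^j)/du_i at u. *)
Definition jac (c c' : chart_index M) (u : 'rV[R]_n) (j i : 'I_n) : R :=
  pderive i (fun v => tr c c' v 0 j) u.

Definition contravariant (k : nat) (T : components k) : Prop :=
  forall c c' u, tr_dom c c' u -> forall J : k.-tuple 'I_n,
    T c' (tr c c' u) J =
    \sum_(I : k.-tuple 'I_n)
      (\prod_(a < k) jac c c' u (tnth J a) (tnth I a)) * T c u I.

Definition covariant (k : nat) (T : components k) : Prop :=
  forall c c' u, tr_dom c c' u -> forall I : k.-tuple 'I_n,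
    T c u I =
    \sum_(J : k.-tuple 'I_n)
      (\prod_(a < k) jac c c' u (tnth J a) (tnth I a)) * T c' (tr c c' u) J.

(* Smooth sections of the k-th exterior power of TM, resp. T*M.  A field with
   components T is 1/k! \sum_I T_I d_I1 /\ ... /\ d_Ik, resp.
   1/k! \sum_I T_I du_I1 /\ ... /\ du_Ik, so that T_I is its value on the
   corresponding k-tuple of basis (co)vectors. *)
Definition multivector_field (k : nat) (T : components k) : Prop :=
  [/\ smooth_components T, alternating T & contravariant T].

Definition diff_form (k : nat) (T : components k) : Prop :=
  [/\ smooth_components T, alternating T & covariant T].

Definition lie_bracket (X Y : components 1) : components 1 := fun c u I =>
  \sum_(l < n) (X c u [tuple l] * pderive l (fun v => Y c v I) u
              - Y c u [tuple l] * pderive l (fun v => X c v I) u).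

(* Local expression of the Schouten-Nijenhuis bracket of two bivector fields,
   a sum over the cyclic permutations of (i, j, k), for the sign convention
   [X_1 /\ ... /\ X_p, Y_1 /\ ... /\ Y_q] =
     \sum_(a, b) (-1)^(a+b) [X_a, Y_b] /\ X_1 /\ (omit X_a) /\ X_p
                                       /\ Y_1 /\ (omit Y_b) /\ Y_q.
   With {f, g} = <P, df /\ dg>, the value of 1/2 [P, P] on (df, dg, dh) is then
   the Jacobiator {f, {g, h}} + {g, {h, f}} + {h, {f, g}}. *)
Definition schouten (P Q : components 2) : components 3 := fun c u I =>
  let term i j k :=
    \sum_(l < n)
      (P c u [tuple i; l] * pderive l (fun v => Q c v [tuple j; k]) u
     + Q c u [tuple i; l] * pderive l (fun v => P c v [tuple j; k]) u) in
  let i := tnth I (inord 0) in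
  let j := tnth I (inord 1) in
  let k := tnth I (inord 2) in
  term i j k + term j k i + term k i j.

Definition ext_d (k : nat) (w : components k) : components k.+1 :=
  fun c u I =>
  \sum_(a < k.+1) (-1) ^+ a *
    pderive (tnth I a) (fun v => w c v [tuple tnth I (lift a b) | b < k]) u.

(* <pi^#(xi), eta> = <pi, xi /\ eta> = \sum_(i, j) pi_ij xi_i eta_j. *)
Definition sharp (P : components 2) (xi : components 1) : components 1 :=
  fun c u J => \sum_(i < n) P c u [tuple i; thead J] * xi c u [tuple i].

(* The map induced by pi^# on k-th exterior powers:
   du_I1 /\ ... /\ du_Ik |-> pi^#(du_I1) /\ ... /\ pi^#(du_Ik). *)
Definition ext_sharp (k : nat) (P : components 2) (w : components k)
  : components k := fun c u J =>
  \sum_(I : k.-tuple 'I_n)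
    (\prod_(a < k) P c u [tuple tnth I a; tnth J a]) * w c u I.

Definition twisted_poisson (P : components 2) (phi : components 3) : Prop :=
  [/\ multivector_field P,
      diff_form phi,
      field_eq (fun c u I => 2^-1 * schouten P P c u I) (ext_sharp P phi)
    & field_eq (ext_d phi) (fun _ _ _ => 0)].

Definition sharp_image (P : components 2) : set (components 1) :=
  [set X | exists2 xi : components 1, diff_form xi & field_eq X (sharp P xi)].

Definition foliated (P : components 2) : Prop :=
  forall X Y, sharp_image P X -> sharp_image P Y ->
    sharp_image P (lie_bracket X Y).

End Tensors.

(* Main.v *)
Require Import Defs.
From HB Require Import structures.
From mathcomp Require Import all_boot all_order all_algebra all_fingroup.
From mathcomp Require Import all_classical all_reals all_analysis.
From mathcomp Require Import ring lra.

(** Write X = pi^#(xi) and Y = pi^#(eta) for two 1-forms xi and eta.  The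
    Lie bracket of X and Y is again in the image of pi^#, because
<<
      [X, Y] = pi^#(zeta),
      zeta = i_X d(eta) - i_Y d(xi) + d(pi(xi, eta)) + phi(X, Y, .).
>>
    The first three terms of zeta are the Koszul bracket of xi and eta.  For
    any bivector field, [X, Y] differs from the image under pi^# of the Koszul
    bracket by the contraction of 1/2 [pi, pi] with xi and eta.  For a twisted
    Poisson structure 1/2 [pi, pi] is the image of phi, and since pi is
    antisymmetric the two signs created when X and Y replace pi(., xi) and
    pi(., eta) cancel: that contraction is pi^#(phi(X, Y, .)).  The identity
    involves the first derivatives of pi, xi and eta at one point only;
    it is [sharp_bracket_identity], and [lie_bracket_sharp] in charts.

    The formula for zeta must also define a 1-form on the manifold, that is,
    be smooth and transform covariantly between charts
    ([diff_form_twisted_bracket]).  As pi(xi, eta) = i_X eta, zeta is built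
    from sharp, interior products and exterior derivatives of functions and
    of 1-forms, so it is enough that each of these operations respects changes
    of charts.  Only the exterior derivative needs calculus: the chain rule
    for functions ([covariant_ext_d0]) and in addition, for 1-forms, the
    symmetry of the second derivatives of the transition maps
    ([covariant_ext_d1]).

    Smoothness is expressed by iterated continuous partial derivatives, so
    the chain rule rests on the differentiability of C^1 functions
    ([C1_differentiable]), and the symmetry is Schwarz's theorem ([pderiveC]);
    both follow from the mean value theorem along coordinate lines
    ([pderive_MVT]). *)

Set Implicit Arguments.
Unset Strict Implicit.
Unset Printing Implicit Defensive.

Import Order.TTheory GRing.Theory Num.Theory.
Import numFieldNormedType.Exports.

Local Open Scope classical_set_scope.
Local Open Scope ring_scope.

(** * Functions of class C^k *)

Section Ck_functions.
Context (R : realType) (n : nat).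
Implicit Types (U : set 'rV[R]_n) (f g : 'rV[R]_n -> R) (i j : 'I_n).

Lemma pderive_eq_on U f g i u : open U -> U u ->
  (forall v, U v -> f v = g v) -> pderive i f u = pderive i g u.
Proof.
move=> oU Uu fg; apply: near_eq_derive.
by apply: filterS (open_nbhs_nbhs (conj oU Uu)) => v /fg.
Qed.

Lemma continuous_eq_on U f g u : open U -> U u ->
  (forall v, U v -> f v = g v) ->
  {for u, continuous f} -> {for u, continuous g}.
Proof.
move=> oU Uu fg cf.
have -> : {for u, continuous g} = (g @ u --> f u) by rewrite (fg _ Uu).
apply: cvg_trans cf; apply: (@near_eq_cvg _ _ (nbhs u)).
by apply: filterS (open_nbhs_nbhs (conj oU Uu)) => v /fg.
Qed.

Lemma Ck_eq_on k U f g : open U -> (forall v, U v -> f v = g v) ->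
  Ck k U f -> Ck k U g.
Proof.
move=> oU; elim: k f g => [|k IH] f g fg [cf df].
  by split=> // u Uu; exact: (continuous_eq_on oU Uu fg (cf u Uu)).
split=> [u Uu|i]; first exact: (continuous_eq_on oU Uu fg (cf u Uu)).
have [dfi Cfi] := df i; split=> [u Uu|].
  apply: near_eq_derivable (dfi u Uu).
  by apply: filterS (open_nbhs_nbhs (conj oU Uu)) => v /fg.
apply: IH Cfi => u Uu; exact: pderive_eq_on oU Uu fg.
Qed.

Lemma CkW k U f : Ck k.+1 U f -> Ck k U f.
Proof.
elim: k f => [|k IH] f [cf df]; split=> // i.
by have [dfi /IH] := df i.
Qed.

Lemma Ck_cst k U (a : R) : Ck k U (fun=> a).
Proof.
elim: k a => [|k IH] a; split=> //; try by move=> u _; exact: cst_continuous.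
move=> i; split=> [u _|]; first exact: derivable_cst.
rewrite (_ : pderive _ _ = fun=> 0) //; apply/funext => u.
exact: derive_cst.
Qed.

Lemma CkD k U f g : open U -> Ck k U f -> Ck k U g ->
  Ck k U (fun u => f u + g u).
Proof.
move=> oU; elim: k f g => [|k IH] f g [cf df] [cg dg].
  by split=> // u Uu; exact: (continuousD (cf u Uu) (cg u Uu)).
split=> [u Uu|i]; first by exact: (continuousD (cf u Uu) (cg u Uu)).
have [[dfi Cfi] [dgi Cgi]] := (df i, dg i); split=> [u Uu|].
  by apply: derivableD; [exact: dfi|exact: dgi].
apply: Ck_eq_on (IH _ _ Cfi Cgi) => // u Uu; apply/esym.
by apply: deriveD; [exact: dfi|exact: dgi].
Qed.

Lemma CkM k U f g : open U -> Ck k U f -> Ck k U g ->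
  Ck k U (fun u => f u * g u).
Proof.
move=> oU; elim: k f g => [|k IH] f g Cf Cg;
  have [cf df] := Cf; have [cg dg] := Cg.
  by split=> // u Uu; exact: (continuousM (cf u Uu) (cg u Uu)).
split=> [u Uu|i]; first by exact: (continuousM (cf u Uu) (cg u Uu)).
have [[dfi Cfi] [dgi Cgi]] := (df i, dg i); split=> [u Uu|].
  by apply: derivableM; [exact: dfi|exact: dgi].
have Csum := CkD oU (IH _ _ (CkW Cf) Cgi) (IH _ _ (CkW Cg) Cfi).
apply: (Ck_eq_on oU _ Csum) => u Uu.
by apply/esym; apply: deriveM; [exact: dfi|exact: dgi].
Qed.

Lemma derivable_translate f (a u v : 'rV[R]_n) :
  derivable f (u + a) v -> derivable (fun x => f (x + a)) u v.
Proof.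
by rewrite /derivable; under [in X in _ -> X]eq_fun do rewrite /= -addrA.
Qed.

Lemma derive_translate f (a u v : 'rV[R]_n) :
  'D_v (fun x => f (x + a)) u = 'D_v f (u + a).
Proof.
by rewrite /derive; under [in LHS]eq_fun do rewrite /= -addrA.
Qed.

(** The mean value theorem along a coordinate line.  The bound on the
    intermediate point by the absolute value of [h] treats both signs of [h]
    at once. *)
Lemma pderive_MVT f i u (h : R) :
  (forall t, `|t| <= `|h| -> derivable f (u + t *: delta_mx 0 i) (delta_mx 0 i)) ->
  exists2 t, `|t| <= `|h| &
    f (u + h *: delta_mx 0 i) - f u = h * pderive i f (u + t *: delta_mx 0 i).
Proof.
move=> df; pose e : 'rV[R]_n := delta_mx 0 i.
pose F (t : R) := f (u + t *: e).
have FE (t : R) : (fun s : R => s^-1 *: ((F \o shift t) (s *: (1 : R)) - F t)) =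
    (fun s : R => s^-1 *: ((f \o shift (u + t *: e)) (s *: e) - f (u + t *: e))).
  apply/funext => s /=; rewrite /F; congr (_ *: (f _ - _)).
  by rewrite [_%:A]mulr1 scalerDl addrCA.
have dF (t : R) : `|t| <= `|h| -> is_derive t 1 F (pderive i f (u + t *: e)).
  move=> th; apply: DeriveDef; last by rewrite /pderive /derive FE.
  by have := df t th; rewrite /derivable FE.
have cF (a b : R) : `|a| <= `|h| -> `|b| <= `|h| ->
    {within `[a, b], continuous F}.
  move=> ha hb; apply: derivable_within_continuous => x.
  rewrite in_itv /= => /andP[ax xb]; apply: (@ex_derive _ _ _ _ _ _ _ (dF x _)).
  move: ha hb; rewrite !ler_norml => /andP[? ?] /andP[? ?].
  by apply/andP; split; lra.
have [h0|h0] := leP 0 h.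
  have [||t] := @MVT_segment _ F (fun t => pderive i f (u + t *: e)) 0 h h0.
  - move=> x; rewrite in_itv /= => /andP[x0 xh]; apply: dF.
    by rewrite !ger0_norm ?(ltW xh)// ltW.
  - by apply: cF; rewrite ?normr0.
  - rewrite in_itv /= => /andP[t0 th] Ft; exists t; first by rewrite !ger0_norm.
    by rewrite mulrC -[h in RHS]subr0 -Ft /F scale0r addr0.
have [||t] := @MVT_segment _ F (fun t => pderive i f (u + t *: e)) h 0 (ltW h0).
- move=> x; rewrite in_itv /= => /andP[hx x0]; apply: dF.
  by rewrite !ltr0_norm// lerN2 ltW.
- by apply: cF; rewrite ?normr0.
- rewrite in_itv /= => /andP[ht t0] Ft.
  exists t; first by rewrite (ltr0_norm h0) ler0_norm// lerN2.
  apply/eqP; rewrite -eqr_opp opprB mulrC -mulrN -[- h]add0r -Ft.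
  by rewrite /F scale0r addr0.
Qed.

End Ck_functions.

(** * Differentiability, symmetry of second derivatives, chain rule *)

Section differentiability.
Context (R : realType) (n : nat).
Implicit Types (U : set 'rV[R]_n) (f : 'rV[R]_n -> R) (u h : 'rV[R]_n) (i j : 'I_n).

(** The vertices of the broken line from [u] to [u + h] that moves along one
    coordinate after the other. *)
Definition staircase u h (k : nat) : 'rV[R]_n :=
  u + \row_i (if (i < k)%N then h 0 i else 0).

Lemma staircase0 u h : staircase u h 0 = u.
Proof. by apply/rowP => i; rewrite !mxE addr0. Qed.

Lemma staircase_last u h : staircase u h n = u + h.
Proof. by apply/rowP => i; rewrite !mxE ltn_ord. Qed.

Lemma staircaseS u h (k : 'I_n) :
  staircase u h k.+1 = staircase u h k + h 0 k *: delta_mx 0 k.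
Proof.
apply/rowP => i; rewrite !mxE eqxx /= -addrA; congr (_ + _).
rewrite ltnS leq_eqVlt; have [->|ik] := eqVneq i k.
  by rewrite eqxx ltnn mulr1 add0r.
by rewrite (negbTE (_ : (i != k :> nat))) ?mulr0 ?addr0.
Qed.

Lemma entry_le_norm h i : `|h 0 i| <= `|h|.
Proof.
rewrite [leRHS]/Num.Def.normr /= mx_normrE.
exact: (le_bigmax _ (fun ij : 'I_1 * 'I_n => `|h ij.1 ij.2|) (0, i)).
Qed.

Lemma rowP_ball (u v : 'rV[R]_n) (e : R) : 0 < e ->
  (forall i, `|u 0 i - v 0 i| < e) -> ball u e v.
Proof. by move=> e0 uv; split=> // a i; rewrite ord1; exact: uv. Qed.

(** Along the [k]-th step of the staircase, [f] grows by [h_k] times its [k]-th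
    partial derivative at some point near [u], which is close to the one at [u]
    by continuity. *)
Lemma C1_first_order f U u : open U -> U u -> Ck 1 U f ->
  forall e : R, 0 < e -> \forall h \near (0 : 'rV[R]_n),
    `|f (u + h) - f u - \sum_(i < n) h 0 i * pderive i f u| <= e * `|h|.
Proof.
move=> oU Uu [_ df] e e0.
(* The error [e] is shared between the [n] steps; [n.+1] avoids dividing by
   zero in dimension 0. *)
have e'0 : 0 < e / n.+1%:R by rewrite divr_gt0.
have : \forall v \near u, U v /\
    forall i, `|pderive i f u - pderive i f v| < e / n.+1%:R.
  apply: filterI; first exact: open_nbhs_nbhs.
  apply: (@filter_forall _ _ _ (nbhs u)) => i.
  have [_ [cfi _]] := df i.
  exact: (@cvgr_dist_lt _ _ _ _ _ _ _ (cfi u Uu)).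
move=> /nbhs_ballP[r /= r0 ur].
near=> h.
have hr i : `|h 0 i| < r.
  apply: le_lt_trans (entry_le_norm h i) _.
  by near: h; exact: (@nbhs0_lt R 'rV[R]_n r r0).
have near_stair (k : 'I_n) (t : R) : `|t| <= `|h 0 k| ->
    ball u r (staircase u h k + t *: delta_mx 0 k).
  move=> th; apply: rowP_ball => // i; rewrite !mxE eqxx /= -addrA opprD addrA.
  rewrite subrr add0r normrN.
  have [->|ik] := eqVneq i k.
    by rewrite ltnn add0r mulr1; exact: le_lt_trans th (hr k).
  by rewrite mulr0 addr0; case: ifP; rewrite ?normr0.
rewrite -(staircase_last u h) -{2}(staircase0 u h).
rewrite -(telescope_sumr (fun k => f (staircase u h k))) ?leq0n// big_mkord.
rewrite -sumrB; apply: le_trans (ler_norm_sum _ _ _) _.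
apply: (@le_trans _ _ (\sum_(k < n) e / n.+1%:R * `|h|)); last first.
  rewrite sumr_const card_ord -mulrnAl ler_wpM2r// -mulr_natr.
  rewrite -mulrA ger_pMr// mulrC ler_pdivrMr// mul1r ler_nat.
  exact: leqnSn.
apply: ler_sum => k _; rewrite staircaseS.
have [t th ->] := @pderive_MVT _ _ f k (staircase u h k) (h 0 k)
  (fun t th => (df k).1 _ (ur _ (near_stair _ _ th)).1).
rewrite -mulrBr normrM mulrC ler_pM//; last exact: entry_le_norm.
by rewrite distrC ltW// (ur _ (near_stair _ _ th)).2.
Unshelve. all: by end_near. Qed.

Lemma C1_differentiable f U u : open U -> U u -> Ck 1 U f ->
  differentiable f u.
Proof.
move=> oU Uu Cf.
pose L (h : 'rV[R]_n) : R := \sum_(i < n) h 0 i * pderive i f u.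
have linL : linear L.
  move=> a x y; rewrite /L scaler_sumr -big_split; apply: eq_bigr => i _.
  by rewrite !mxE mulrDl; congr (_ + _); exact/esym/mulrA.
pose LM := GRing.isLinear.Build _ _ _ _ _ linL.
pose Ll : {linear _ -> _} := HB.pack L LM.
have cL : continuous L.
  apply: continuous_big => [|i _ x]; first exact: add_continuous.
  by apply: (@cvgMr_tmp _ _ (nbhs x)); exact: (@coord_continuous R 1 n 0 i x).
have dE : f \o shift u = cst (f u) + Ll +o_ (0 : 'rV[R]_n) id.
  apply/eqaddoP => e e0; near=> h.
  suff : `|f (u + h) - f u - L h| <= e * `|h|.
    by rewrite /= fctE opprD addrA [u + h]addrC.
  by near: h; exact: (C1_first_order oU Uu Cf e0).
have dfE : 'd f u = Ll :> ('rV[R]_n -> R).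
  exact: (@diff_unique R 'rV[R]_n R f Ll u cL dE).
by apply/diff_locallyP; rewrite dfE.
Unshelve. all: by end_near. Qed.

(** The mean value theorem is applied in direction [i] to the increment of [f]
    in direction [j], and then in direction [j] to the [i]-th partial
    derivative of [f]. *)
Lemma C2_second_difference f i j (V : set 'rV[R]_n) u (s : R) :
  (forall v, V v -> derivable f v (delta_mx 0 i)) ->
  (forall v, V v -> derivable (pderive i f) v (delta_mx 0 j)) ->
  (forall a b : R, `|a| <= `|s| -> `|b| <= `|s| ->
     V (u + a *: delta_mx 0 i + b *: delta_mx 0 j)) ->
  exists a b : R, [/\ `|a| <= `|s|, `|b| <= `|s| &
    f (u + s *: delta_mx 0 i + s *: delta_mx 0 j) - f (u + s *: delta_mx 0 i)
    - (f (u + s *: delta_mx 0 j) - f u) =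
    s * (s * pderive j (pderive i f)
               (u + a *: delta_mx 0 i + b *: delta_mx 0 j))].
Proof.
move=> dif djf sV.
have V0 a : `|a| <= `|s| -> V (u + a *: delta_mx 0 i).
  by move=> ha; have := sV a 0 ha; rewrite normr0 scale0r addr0; exact.
pose g v := f (v + s *: delta_mx 0 j) - f v.
have dg a : `|a| <= `|s| ->
    derivable g (u + a *: delta_mx 0 i) (delta_mx 0 i).
  move=> ha; apply: derivableB; last exact/dif/V0.
  by apply: derivable_translate; exact/dif/sV.
have [a ha gE] := pderive_MVT dg.
have [b hb fE] := @pderive_MVT _ _ (pderive i f) j (u + a *: delta_mx 0 i) s
  (fun b hb => djf _ (sV a b ha hb)).
exists a, b; split=> //.
rewrite -fE -/(g _) -[f (_ + s *: delta_mx 0 j) - f u]/(g u) gE.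
congr (_ * _); rewrite -[RHS]/('D_(delta_mx 0 i) f _ - _) -derive_translate.
apply: deriveB; last exact/dif/V0.
by apply: derivable_translate; exact/dif/sV.
Qed.

(** Schwarz's theorem.  The second difference of [f] over a small square does
    not depend on the order of the two directions, so both mixed derivatives,
    taken at two points of the square, are equal; continuity brings
    these points to [u]. *)
Lemma pderiveC f U u i j : open U -> U u -> Ck 2 U f ->
  pderive i (pderive j f) u = pderive j (pderive i f) u.
Proof.
move=> oU Uu [_ Cf].
have dif k v : U v -> derivable f v (delta_mx 0 k) by have [+ _] := Cf k; apply.
have djf k l v : U v -> derivable (pderive k f) v (delta_mx 0 l).
  by have [_ [_ /(_ l)[+ _]]] := Cf k; apply.
have cf k l : {for u, continuous (pderive l (pderive k f))}.
  by have [_ [_ /(_ l)[_ [+ _]]]] := Cf k; apply.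
apply/eqP; rewrite -subr_eq0 -normr_le0; apply/ler_addgt0Pr => e e0.
rewrite add0r.
have e20 : 0 < e / 2 by rewrite divr_gt0.
have : \forall v \near u, U v /\ forall kl : 'I_n * 'I_n,
    `|pderive kl.2 (pderive kl.1 f) u - pderive kl.2 (pderive kl.1 f) v| < e / 2.
  apply: filterI; first exact: open_nbhs_nbhs.
  apply: (@filter_forall _ _ _ (nbhs u)) => kl.
  exact: (@cvgr_dist_lt _ _ _ _ _ _ _ (cf kl.1 kl.2)).
move=> /nbhs_ballP[r /= r0 ur].
(* Two steps of length at most [s] stay in the ball of radius [r]. *)
pose s := r / 3.
have s0 : 0 < s by rewrite divr_gt0.
have box (k l : 'I_n) a b : `|a| <= `|s| -> `|b| <= `|s| ->
    ball u r (u + a *: delta_mx 0 k + b *: delta_mx 0 l).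
  move=> ha hb; apply: rowP_ball => // m; rewrite !mxE eqxx /= -addrA opprD addrA.
  rewrite subrr add0r normrN.
  apply: (@le_lt_trans _ _ (s + s)); last by rewrite /s; lra.
  rewrite (gtr0_norm s0) in ha hb; apply: (le_trans (ler_normD _ _)).
  by apply: lerD; case: eqP; rewrite ?mulr1 ?mulr0 ?normr0 // ltW.
have [a [b [ha hb E1]]] := @C2_second_difference f i j (ball u r) u s
  (fun v uv => dif i v (ur v uv).1)
  (fun v uv => djf i j v (ur v uv).1) (box i j).
have [a' [b' [ha' hb' E2]]] := @C2_second_difference f j i (ball u r) u s
  (fun v uv => dif j v (ur v uv).1)
  (fun v uv => djf j i v (ur v uv).1) (box j i).
have /= D1 := (ur _ (box i j a b ha hb)).2 (i, j).
have /= D2 := (ur _ (box j i a' b' ha' hb')).2 (j, i).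
set p := pderive j (pderive i f) (_ + _) in E1 D1.
set q := pderive i (pderive j f) (_ + _) in E2 D2.
clearbody p q.
have pq : p = q.
  apply: (mulfI (lt0r_neq0 s0)); apply: (mulfI (lt0r_neq0 s0)).
  rewrite -[LHS]E1 -[RHS]E2 [X in f X - _ - _ = _]addrAC.
  move: (f (_ + _ + _)) (f (u + s *: delta_mx 0 i)) => A B.
  by move: (f (u + s *: delta_mx 0 j)) (f u) => C D; ring.
rewrite pq in D1; rewrite distrC in D1.
have := ler_normD (pderive i (pderive j f) u - q) (q - pderive j (pderive i f) u).
rewrite subrKA => /le_trans; apply; lra.
Qed.

End differentiability.

(** Reduces a directional derivative to a derivative in one variable, where
    derivability and differentiability coincide. *)
Lemma derive_line (R : realType) (V W : normedModType R) (f : V -> W) (u v : V) :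
  'D_v f u = 'D_1 (fun t : R => f (t *: v + u)) 0.
Proof.
rewrite /derive; set g1 := fun h => h^-1 *: _; set g2 := fun h => h^-1 *: _.
suff -> : g1 = g2 by [].
by apply/funext => h; rewrite /g1 /g2 /= addr0 scale0r add0r [_%:A]mulr1.
Qed.

(** The chain rule, for an inner map that is only known to have directional
    derivatives: its restriction to a line is differentiable. *)
Lemma derive_comp_row (R : realType) (n m : nat) (f : 'rV[R]_m -> R)
    (g : 'rV[R]_n -> 'rV[R]_m) (u v : 'rV[R]_n) :
  differentiable f (g u) ->
  (forall j, derivable (fun x => g x 0 j) u v) ->
  derivable (fun x => f (g x)) u v /\
  'D_v (fun x => f (g x)) u =
  \sum_(j < m) pderive j f (g u) * 'D_v (fun x => g x 0 j) u.
Proof.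
move=> df dg.
have dgu : derivable g u v by apply/derivable_mxP => i j; rewrite ord1.
pose c (h : R) := g (h *: v + u).
have c0 : c 0 = g u by rewrite /c scale0r add0r.
have dc : differentiable c 0.
  by apply/derivable1_diffP; exact: (derivable1P g u v).1 dgu.
rewrite -c0 in df; have dfc := differentiable_comp dc df.
split; first exact: (derivable1P (f \o g) u v).2 ((derivable1_diffP _ _).2 dfc).
rewrite derive_line -[fun t => _]/(f \o c) deriveE// diff_comp//= c0.
rewrite -(@deriveE _ _ _ c 0 1 dc) -[X in 'd f _ X](derive_line g u v) derive_mx//.
rewrite [X in 'd f _ X]row_sum_delta linear_sum; apply: eq_bigr => j _.
rewrite linearZ /= mxE mulrC; congr (_ * _).
by rewrite /pderive -c0 deriveE.
Qed.

(** * Smooth functions on an open set *)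

Section smooth_functions.
Context (R : realType) (n : nat) (U : set 'rV[R]_n) (oU : open U).
Implicit Types f g : 'rV[R]_n -> R.

Lemma smooth_cst (a : R) : smooth_on U (fun=> a).
Proof. by move=> k; exact: Ck_cst. Qed.

Lemma smoothD f g : smooth_on U f -> smooth_on U g ->
  smooth_on U (fun u => f u + g u).
Proof. by move=> sf sg k; exact: CkD. Qed.

Lemma smoothM f g : smooth_on U f -> smooth_on U g ->
  smooth_on U (fun u => f u * g u).
Proof. by move=> sf sg k; exact: CkM. Qed.

Lemma smoothB f g : smooth_on U f -> smooth_on U g ->
  smooth_on U (fun u => f u - g u).
Proof.
move=> sf sg; under eq_fun do rewrite -mulN1r.
by apply: smoothD => //; apply: smoothM => //; exact: smooth_cst.
Qed.

Lemma smooth_sum (I : Type) (r : seq I) (f : I -> 'rV[R]_n -> R) :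
  (forall i, smooth_on U (f i)) -> smooth_on U (fun u => \sum_(i <- r) f i u).
Proof.
move=> sf; elim: r => [|i r IH].
  by under eq_fun do rewrite big_nil; exact: smooth_cst.
by under eq_fun do rewrite big_cons; exact: smoothD.
Qed.

Lemma smooth_pderive f i : smooth_on U f -> smooth_on U (pderive i f).
Proof. by move=> sf k; have [_ /(_ i)[]] := sf k.+1. Qed.

Lemma smooth_derivable f i u : smooth_on U f -> U u ->
  derivable f u (delta_mx 0 i).
Proof. by move=> sf Uu; have [_ /(_ i)[+ _]] := sf 1%N; apply. Qed.

Lemma smooth_differentiable f u : smooth_on U f -> U u -> differentiable f u.
Proof. by move=> sf Uu; exact: (C1_differentiable oU Uu (sf 1%N)). Qed.

End smooth_functions.

Section pderive_rules.
Context (R : realType) (n : nat).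
Implicit Types (f g : 'rV[R]_n -> R) (i : 'I_n).

Lemma pderiveM f g i u : derivable f u (delta_mx 0 i) ->
  derivable g u (delta_mx 0 i) ->
  pderive i (fun v => f v * g v) u = f u * pderive i g u + pderive i f u * g u.
Proof. by move=> df dg; rewrite [pderive i f u * _]mulrC -[RHS](deriveM df dg). Qed.

Lemma pderive_sum (m : nat) (f : 'I_m -> 'rV[R]_n -> R) i u :
  (forall a, derivable (f a) u (delta_mx 0 i)) ->
  pderive i (fun v => \sum_(a < m) f a v) u = \sum_(a < m) pderive i (f a) u.
Proof.
move=> df; rewrite /pderive -(derive_sum df); congr (derive _ _ _).
by apply/funext => v; rewrite fct_sumE.
Qed.

End pderive_rules.

(** * Sums over multi-indices *)

Section tuple_sums.
Context (R : nzRingType) (T : finType).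

Lemma big_tuple0 (F : 0.-tuple T -> R) : \sum_I F I = F [tuple].
Proof. by rewrite (big_pred1 [tuple])// => I; apply/esym/eqP; exact: tuple0. Qed.

Lemma big_tupleS k (F : k.+1.-tuple T -> R) :
  \sum_I F I = \sum_i \sum_(J : k.-tuple T) F [tuple of i :: J].
Proof.
rewrite pair_big /=.
rewrite (reindex (fun p : T * k.-tuple T => [tuple of p.1 :: p.2])) //=.
exists (fun I => (thead I, [tuple of behead I])) => [[i J] _|I _] /=.
  by congr pair; apply: val_inj.
by rewrite -tuple_eta.
Qed.

Lemma cons_tuple0 (i : T) (I : 0.-tuple T) : [tuple of i :: I] = [tuple i].
Proof. by apply: val_inj; rewrite /= (tuple0 I). Qed.

Lemma tuple1_thead (I : 1.-tuple T) : I = [tuple thead I].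
Proof. by case/tupleP: I => i I; rewrite theadE cons_tuple0. Qed.

Lemma cons_tuple1 (i j : T) : [tuple of i :: [tuple j]] = [tuple i; j].
Proof. exact: val_inj. Qed.

Lemma big_tuple1 (F : 1.-tuple T -> R) : \sum_I F I = \sum_i F [tuple i].
Proof.
by rewrite big_tupleS; apply: eq_bigr => i _; rewrite big_tuple0 cons_tuple0.
Qed.

Lemma big_tuple2 (F : 2.-tuple T -> R) : \sum_I F I = \sum_i \sum_j F [tuple i; j].
Proof.
rewrite big_tupleS; apply: eq_bigr => i _; rewrite big_tuple1.
by apply: eq_bigr => j _; rewrite cons_tuple1.
Qed.

Lemma big_tuple3 (F : 3.-tuple T -> R) :
  \sum_I F I = \sum_i \sum_j \sum_k F [tuple i; j; k].
Proof.
rewrite big_tupleS; apply: eq_bigr => i _; rewrite big_tuple2.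
apply: eq_bigr => j _; apply: eq_bigr => k _; congr F; exact: val_inj.
Qed.

End tuple_sums.

(** * Operations on tensor fields and changes of charts *)

Section fields.
Context (R : realType) (n : nat) (M : smooth_manifold R n).
Local Notation chart c := (charts (s := M) c).
Local Notation dom c := (ccod (chart c)).
Local Notation tr c c' := (transition (chart c) (chart c')).
Local Notation tr_dom c c' := (transition_dom (chart c) (chart c')).
Implicit Types (c : chart_index M) (u : 'rV[R]_n) (i j l : 'I_n).

Lemma ccod_chart_open c : open (dom c).
Proof. exact: ccod_open. Qed.
Arguments ccod_chart_open : clear implicits.

Lemma transition_dom_open c c' : open (tr_dom c c').
Proof.
rewrite openE => u [uc uc'].
have nc : nbhs u (dom c) := open_nbhs_nbhs (conj (ccod_chart_open c) uc).
apply: (filterI nc); apply: (cinv_continuous uc).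
exact: (open_nbhs_nbhs (conj (@cdom_open _ _ _ (chart c')) uc')).
Qed.
Arguments transition_dom_open : clear implicits.

Lemma transition_ccod c c' u : tr_dom c c' u -> dom c' (tr c c' u).
Proof. by move=> [_ uc']; exists (cinv (chart c) u). Qed.

Lemma smooth_jac c c' a i : smooth_on (tr_dom c c') (fun u => jac c c' u a i).
Proof. by apply: smooth_pderive; exact: charts_compatible. Qed.

Lemma pderive_transition c c' u f i :
  tr_dom c c' u -> smooth_on (dom c') f ->
  derivable (fun v => f (tr c c' v)) u (delta_mx 0 i) /\
  pderive i (fun v => f (tr c c' v)) u =
  \sum_a jac c c' u a i * pderive a f (tr c c' u).
Proof.
move=> uc sf.
have dtr a : derivable (fun v => tr c c' v 0 a) u (delta_mx 0 i).
  exact: (smooth_derivable (charts_compatible c c' a) uc).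
have df : differentiable f (tr c c' u).
  exact: (smooth_differentiable (ccod_chart_open c') sf (transition_ccod uc)).
have [dft dE] := derive_comp_row df dtr.
split=> //; by rewrite [LHS]dE; apply: eq_bigr => a _; rewrite mulrC.
Qed.

Lemma covariant1P (w : components M 1) : covariant w -> 
  forall c c' u, tr_dom c c' u -> forall i,
  w c u [tuple i] = \sum_a jac c c' u a i * w c' (tr c c' u) [tuple a].
Proof.
move=> cw c c' u uc i; rewrite (cw c c' u uc) big_tuple1.
by apply: eq_bigr => a _; rewrite big_ord1 !(tnth_nth i).
Qed.

Lemma contravariant1P (X : components M 1) : contravariant X <->
  forall c c' u, tr_dom c c' u -> forall a,
  X c' (tr c c' u) [tuple a] = \sum_i jac c c' u a i * X c u [tuple i].
Proof.
split=> [cX c c' u uc a|cX c c' u uc I].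
  rewrite (cX c c' u uc) big_tuple1.
  by apply: eq_bigr => i _; rewrite big_ord1 !(tnth_nth i).
rewrite (tuple1_thead I) (cX c c' u uc) big_tuple1.
by apply: eq_bigr => i _; rewrite big_ord1 !(tnth_nth i).
Qed.

Definition interior_product (k : nat) (X : components M 1) (w : components M k.+1) :
  components M k := fun c u I => \sum_l X c u [tuple l] * w c u [tuple of l :: I].

(** The Jacobian factor of the first index of [w] moves over to [X]. *)
Lemma covariant_interior_product k X (w : components M k.+1) :
  contravariant X -> covariant w -> covariant (interior_product X w).
Proof.
move=> /contravariant1P cX cw c c' u uc I; rewrite /interior_product.
under eq_bigr => l _ do rewrite (cw c c' u uc) mulr_sumr big_tupleS exchange_big /=.
rewrite exchange_big /=; apply: eq_bigr => J _.
rewrite exchange_big mulr_sumr /=; apply: eq_bigr => a _.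
rewrite (cX c c' u uc) mulr_suml mulr_sumr; apply: eq_bigr => l _.
rewrite big_ord_recl !tnth0.
have -> : \prod_(b < k) jac c c' u (tnth [tuple of a :: J] (lift ord0 b))
      (tnth [tuple of l :: I] (lift ord0 b)) =
    \prod_(b < k) jac c c' u (tnth J b) (tnth I b).
  by apply: eq_bigr => b _; rewrite !tnthS.
by ring.
Qed.

Lemma smooth_interior_product k X (w : components M k.+1) :
  smooth_components X -> smooth_components w ->
  smooth_components (interior_product X w).
Proof.
move=> sX sw c I; apply: (smooth_sum (ccod_chart_open c)) => l.
by apply: (smoothM (ccod_chart_open c)); [exact: sX|exact: sw].
Qed.

Lemma smooth_ext_d k (w : components M k) :
  smooth_components w -> smooth_components (ext_d w).
Proof.
move=> sw c I; apply: (smooth_sum (ccod_chart_open c)) => a.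
apply: (smoothM (ccod_chart_open c)); first exact: smooth_cst.
exact: smooth_pderive.
Qed.

Lemma ext_d0E (h : components M 0) c u i :
  ext_d h c u [tuple i] = pderive i (fun v => h c v [tuple]) u.
Proof.
rewrite /ext_d big_ord1 expr0 mul1r; congr (pderive _ _ u).
by apply/funext => v; congr (h c v); exact: tuple0.
Qed.

Lemma ext_d1E (w : components M 1) c u i j :
  ext_d w c u [tuple i; j] =
  pderive i (fun v => w c v [tuple j]) u - pderive j (fun v => w c v [tuple i]) u.
Proof.
rewrite /ext_d big_ord_recl big_ord1 expr0 mul1r expr1 mulN1r.
congr (pderive _ _ u - pderive _ _ u); apply/funext => v; congr (w c v);
  by apply: eq_from_tnth => a; rewrite tnth_mktuple (ord1 a) !(tnth_nth i).
Qed.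

Lemma covariant_ext_d0 (h : components M 0) :
  smooth_components h -> covariant h -> covariant (ext_d h).
Proof.
move=> sh ch c c' u uc I.
have hE v : tr_dom c c' v -> h c v [tuple] = h c' (tr c c' v) [tuple].
  by move=> vc; rewrite (ch c c' v vc) big_tuple0 big_ord0 mul1r.
rewrite (tuple1_thead I) ext_d0E big_tuple1.
rewrite (pderive_eq_on _ (transition_dom_open c c') uc hE).
rewrite (pderive_transition _ uc (sh c' [tuple])).2.
by apply: eq_bigr => a _; rewrite big_ord1 !(tnth_nth (thead I)) ext_d0E.
Qed.

(** By the chain rule, the derivative of [w] in one chart is the expected
    covariant term plus a term in the second derivatives of the transition
    map; the latter is symmetric, and disappears in the exterior derivative. *)
Lemma covariant_ext_d1 (w : components M 1) :
  smooth_components w -> covariant w -> covariant (ext_d w).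
Proof.
move=> sw cw c c' u uc I.
have oU := transition_dom_open c c'.
pose J v a i := jac c c' v a i.
(* [S] is the second-order term and [T] the covariant one. *)
pose S l k := \sum_a pderive l (fun v => J v a k) u * w c' (tr c c' u) [tuple a].
pose T l k := \sum_a \sum_b J u b l * J u a k *
  pderive b (fun v => w c' v [tuple a]) (tr c c' u).
have dE l k : pderive l (fun v => w c v [tuple k]) u = S l k + T l k.
  rewrite (pderive_eq_on _ oU uc (fun v vc => covariant1P cw vc k)).
  have dJ a := smooth_derivable (i := l) (smooth_jac c c' a k) uc.
  have dw a := pderive_transition l uc (sw c' [tuple a]).
  rewrite pderive_sum => [|a]; last exact: derivableM (dJ a) (dw a).1.
  rewrite -big_split; apply: eq_bigr => a _ /=.
  rewrite pderiveM ?(dw a).2; [|exact: dJ|exact: (dw a).1].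
  rewrite addrC mulr_sumr; congr (_ + _); apply: eq_bigr => b _.
  by rewrite mulrA [J u b l * _]mulrC.
have SC l k : S l k = S k l.
  rewrite /S; apply: eq_bigr => a _.
  have jacC : pderive l (fun v => J v a k) u = pderive k (fun v => J v a l) u.
    exact: (pderiveC l k oU uc (charts_compatible c c' a 2)).
  exact: (congr1 ( *%R^~ _) jacC).
case/tupleP: I => l I; rewrite (tuple1_thead I); move: (thead I) => k {I}.
rewrite cons_tuple1 ext_d1E !dE (SC k l) opprD addrACA subrr add0r big_tuple2.
under [RHS]eq_bigr => a _ do under eq_bigr => b _ do
  rewrite ext_d1E big_ord_recl big_ord1 !(tnth_nth l) /= mulrBr.
under [RHS]eq_bigr => a _ do rewrite sumrB.
rewrite sumrB; congr (_ - _); rewrite /T; first exact: exchange_big.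
by apply: eq_bigr => a _; apply: eq_bigr => b _; rewrite [J u b k * _]mulrC.
Qed.

Lemma contravariant_sharp P (xi : components M 1) :
  contravariant P -> covariant xi -> contravariant (sharp P xi).
Proof.
move=> cP cxi; apply/contravariant1P => c c' u uc b; rewrite /sharp.
under eq_bigr => a _ do rewrite (cP c c' u uc) big_tuple2 exchange_big mulr_suml.
rewrite exchange_big; apply: eq_bigr => j _ /=.
rewrite mulr_sumr.
under [RHS]eq_bigr => i _ do rewrite (covariant1P cxi uc) !mulr_sumr.
rewrite exchange_big; apply: eq_bigr => a _ /=; rewrite mulr_suml.
apply: eq_bigr => i _; rewrite big_ord_recl big_ord1 !(tnth_nth i) /= !theadE.
by rewrite -!mulrA mulrCA; congr (_ * _); rewrite mulrCA.
Qed.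

Lemma smooth_sharp P (xi : components M 1) :
  smooth_components P -> smooth_components xi -> smooth_components (sharp P xi).
Proof.
move=> sP sxi c I; apply: (smooth_sum (ccod_chart_open c)) => i.
by apply: (smoothM (ccod_chart_open c)); [exact: sP|exact: sxi].
Qed.

End fields.
Arguments ccod_chart_open {R n M} c.

(** * The bracket identity at a point *)

Section pointwise_identity.
Context (R : comNzRingType) (n : nat).

(** Leibniz' rule for the derivative along [X] of the sharp of [b].  Here and
    in the next lemma, all letters are values at one point: [P] and [dP l] stand
    for a bivector field and its [l]-th partial derivative, [b] and [db l]
    for a 1-form and its [l]-th partial derivative, and likewise for the others. *)
Lemma directional_sharp (P : 'I_n -> 'I_n -> R) (dP : 'I_n -> 'I_n -> 'I_n -> R)
    (a b X : 'I_n -> R) (db dY : 'I_n -> 'I_n -> R) k :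
  (forall j, X j = \sum_i P i j * a i) ->
  (forall l j, dY l j = \sum_i (P i j * db l i + dP l i j * b i)) ->
  \sum_l X l * dY l k = \sum_m P m k * (\sum_l X l * db l m) +
    \sum_i \sum_j a i * b j * \sum_l P i l * dP l j k.
Proof.
move=> XE dYE.
under eq_bigr => l _ do rewrite dYE big_split mulrDr !mulr_sumr.
rewrite big_split /=; congr (_ + _).
  rewrite exchange_big; apply: eq_bigr => m _; rewrite mulr_sumr.
  by apply: eq_bigr => l _; rewrite mulrCA.
rewrite exchange_big [RHS]exchange_big; apply: eq_bigr => j _ /=.
under [RHS]eq_bigr => i _ do rewrite mulr_sumr.
rewrite [RHS]exchange_big; apply: eq_bigr => l _ /=.
rewrite XE mulr_suml; apply: eq_bigr => i _; ring.
Qed.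

(** After Leibniz' rule, the derivatives of [xi] and [eta] agree on both sides.
    What remains is the pairing of [xi] and [eta] with the cyclic sum on the left
    of the Jacobi hypothesis, and the term in [phi] is the same pairing with its
    right-hand side. *)
Lemma sharp_bracket_identity (P : 'I_n -> 'I_n -> R)
    (dP phi : 'I_n -> 'I_n -> 'I_n -> R)
    (xi eta : 'I_n -> R) (dxi deta dX dY : 'I_n -> 'I_n -> R) (X Y : 'I_n -> R) :
  (forall i j, P i j = - P j i) ->
  (forall l i j, dP l i j = - dP l j i) ->
  (forall i j k,
    \sum_l P i l * dP l j k + \sum_l P j l * dP l k i + \sum_l P k l * dP l i j =
    \sum_a \sum_b \sum_m P a i * P b j * P m k * phi a b m) ->
  (forall j, X j = \sum_i P i j * xi i) ->
  (forall j, Y j = \sum_i P i j * eta i) ->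
  (forall l j, dX l j = \sum_i (P i j * dxi l i + dP l i j * xi i)) ->
  (forall l j, dY l j = \sum_i (P i j * deta l i + dP l i j * eta i)) ->
  forall k, \sum_l (X l * dY l k - Y l * dX l k) =
    \sum_m P m k * (\sum_l X l * (deta l m - deta m l)
                    - \sum_l Y l * (dxi l m - dxi m l)
                    + \sum_l (X l * deta m l + dX m l * eta l)
                    + \sum_b Y b * \sum_a X a * phi a b m).
Proof.
move=> PC dPC jacobi XE YE dXE dYE k.
(* The derivative of the function P(xi, eta) cancels one half of each of the
   two exterior derivatives. *)
have form_simpl m : \sum_l X l * (deta l m - deta m l)
    - \sum_l Y l * (dxi l m - dxi m l) + \sum_l (X l * deta m l + dX m l * eta l) =
    \sum_l X l * deta l m - \sum_l Y l * dxi l m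
    + \sum_i \sum_j dP m i j * xi i * eta j.
  have -> : \sum_l (X l * deta m l + dX m l * eta l) = \sum_l X l * deta m l
      - \sum_l Y l * dxi m l + \sum_i \sum_j dP m i j * xi i * eta j.
    rewrite big_split -addrA /=; congr (_ + _).
    under eq_bigr => l _ do rewrite dXE mulr_suml.
    rewrite exchange_big -sumrN -big_split; apply: eq_bigr => i _ /=.
    rewrite YE mulr_suml -sumrN -big_split; apply: eq_bigr => j _ /=.
    rewrite (PC j i); ring.
  under eq_bigr => l _ do rewrite mulrBr.
  under [X in _ - X]eq_bigr => l _ do rewrite mulrBr.
  rewrite !sumrB; ring.
under [RHS]eq_bigr => m _ do rewrite form_simpl.
pose pair (T : 'I_n -> 'I_n -> R) := \sum_i \sum_j xi i * eta j * T i j.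
have pairD T S : pair (fun i j => T i j + S i j) = pair T + pair S.
  rewrite -big_split; apply: eq_bigr => i _; rewrite -big_split.
  by apply: eq_bigr => j _; exact: mulrDr.
have YdX : \sum_l Y l * dX l k = \sum_m P m k * \sum_l Y l * dxi l m
    - pair (fun i j => \sum_l P j l * dP l k i).
  rewrite (directional_sharp k YE dXE); congr (_ + _).
  rewrite exchange_big -sumrN; apply: eq_bigr => i _; rewrite -sumrN.
  apply: eq_bigr => j _; rewrite -mulrN -sumrN [eta j * _]mulrC; congr (_ * _).
  apply: eq_bigr => l _.
  by rewrite (dPC l i) mulrN.
have PdP : \sum_m P m k * \sum_i \sum_j dP m i j * xi i * eta j =
    - pair (fun i j => \sum_l P k l * dP l i j).
  under eq_bigr => m _ do rewrite mulr_sumr.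
  rewrite exchange_big -sumrN; apply: eq_bigr => i _ /=.
  under eq_bigr => m _ do rewrite mulr_sumr.
  rewrite exchange_big -sumrN; apply: eq_bigr => j _ /=.
  rewrite mulr_sumr -sumrN; apply: eq_bigr => l _.
  rewrite (PC l k); ring.
have PYX : \sum_m P m k * \sum_b Y b * \sum_a X a * phi a b m =
    pair (fun i j => \sum_a \sum_b \sum_m P a i * P b j * P m k * phi a b m).
  have rot (T : 'I_n -> 'I_n -> 'I_n -> R) :
      \sum_i \sum_j xi i * eta j * (\sum_a T i j a) =
      \sum_a \sum_i \sum_j xi i * eta j * T i j a.
    under eq_bigr => i _ do under eq_bigr => j _ do rewrite mulr_sumr.
    by under eq_bigr => i _ do rewrite exchange_big; exact: exchange_big.
  rewrite /pair rot.
  under eq_bigr => m _ do rewrite mulr_sumr.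
  under eq_bigr => m _ do under eq_bigr => b _ do rewrite !mulr_sumr.
  rewrite exchange_big; under eq_bigr => b _ do rewrite exchange_big.
  rewrite exchange_big; apply: eq_bigr => a _; rewrite rot; apply: eq_bigr => b _.
  rewrite rot; apply: eq_bigr => m _ /=.
  have -> : P m k * (Y b * (X a * phi a b m)) = P m k * phi a b m * (X a * Y b).
    by ring.
  rewrite XE YE big_distrlr mulr_sumr; apply: eq_bigr => i _ /=.
  rewrite mulr_sumr; apply: eq_bigr => j _.
  rewrite (PC a i) (PC b j); ring.
rewrite sumrB (directional_sharp k XE dYE) YdX.
under [RHS]eq_bigr => m _ do rewrite !mulrDr mulrN.
rewrite !big_split sumrN /= PdP PYX.
have -> : pair (fun i j => \sum_a \sum_b \sum_m P a i * P b j * P m k * phi a b m) =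
    pair (fun i j => \sum_l P i l * dP l j k + \sum_l P j l * dP l k i
                     + \sum_l P k l * dP l i j).
  by apply: eq_bigr => i _; apply: eq_bigr => j _; rewrite jacobi.
rewrite !pairD -/(pair _); ring.
Qed.
End pointwise_identity.

(** * The bracket of vector fields in the image of a bivector field *)

Section bracket.
Context (R : realType) (n : nat) (M : smooth_manifold R n).
Local Notation dom c := (ccod (charts (s := M) c)).
Implicit Types (c : chart_index M) (u : 'rV[R]_n) (i j k l : 'I_n).

Lemma alternating2 (P : components M 2) : Defs.alternating P ->
  forall c u, dom c u -> forall i j, P c u [tuple i; j] = - P c u [tuple j; i].
Proof.
move=> aP c u uc i j; pose s : 'S_2 := tperm ord0 (lift ord0 ord0).
have := aP c u uc s [tuple j; i].
have -> : [tuple tnth [tuple j; i] (s a) | a < 2] = [tuple i; j].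
  apply: eq_from_tnth => a; rewrite tnth_mktuple.
  case: (unliftP ord0 a) => [b|] ->; first rewrite (ord1 b).
    by rewrite tpermR !(tnth_nth i).
  by rewrite tpermL !(tnth_nth i).
by rewrite odd_tperm expr1 mulN1r.
Qed.

(** There is only one permutation of a single index, so 1-forms only have to
    be smooth and covariant. *)
Lemma alternating1 (w : components M 1) : Defs.alternating w.
Proof.
move=> c u _ s I; have -> : s = 1%g by apply/permP => a; rewrite !ord1.
rewrite odd_perm1 expr0 mul1r; congr (w c u).
by apply: eq_from_tnth => a; rewrite tnth_mktuple perm1.
Qed.

Lemma half_schoutenE (P : components M 2) c u i j k :
  2^-1 * schouten P P c u [tuple i; j; k] =
  \sum_l P c u [tuple i; l] * pderive l (fun v => P c v [tuple j; k]) u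
  + \sum_l P c u [tuple j; l] * pderive l (fun v => P c v [tuple k; i]) u
  + \sum_l P c u [tuple k; l] * pderive l (fun v => P c v [tuple i; j]) u.
Proof.
rewrite /schouten !(tnth_nth i) !inordK //= !big_split /=.
by field.
Qed.

Lemma ext_sharp3E (P : components M 2) (w : components M 3) c u i j k :
  ext_sharp P w c u [tuple i; j; k] =
  \sum_a \sum_b \sum_d P c u [tuple a; i] * P c u [tuple b; j]
                       * P c u [tuple d; k] * w c u [tuple a; b; d].
Proof.
rewrite /ext_sharp big_tuple3; apply: eq_bigr => a _; apply: eq_bigr => b _.
apply: eq_bigr => d _; rewrite !big_ord_recl big_ord0 !(tnth_nth i) /=.
by rewrite mulr1 !mulrA.
Qed.

Lemma pderive_sharp (P : components M 2) (xi : components M 1) c u l j :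
  smooth_components P -> smooth_components xi -> dom c u ->
  pderive l (fun v => sharp P xi c v [tuple j]) u =
  \sum_i (P c u [tuple i; j] * pderive l (fun v => xi c v [tuple i]) u
          + pderive l (fun v => P c v [tuple i; j]) u * xi c u [tuple i]).
Proof.
move=> sP sxi uc.
have dP i := smooth_derivable (i := l) (sP c [tuple i; j]) uc.
have dxi i := smooth_derivable (i := l) (sxi c [tuple i]) uc.
rewrite pderive_sum => [|i]; last exact: derivableM (dP i) (dxi i).
by apply: eq_bigr => i _; rewrite pderiveM.
Qed.

(** The bracket differentiates its arguments, but equality of fields holds on
    open sets, where it passes to the derivatives. *)
Lemma lie_bracket_eq (X X' Y Y' : components M 1) :
  field_eq X X' -> field_eq Y Y' -> field_eq (lie_bracket X Y) (lie_bracket X' Y').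
Proof.
move=> XX' YY' c u uc I; apply: eq_bigr => l _.
have oU := ccod_chart_open c.
rewrite !XX'// !YY'//.
rewrite (pderive_eq_on l oU uc (fun v vc => YY' c v vc I)).
by rewrite (pderive_eq_on l oU uc (fun v vc => XX' c v vc I)).
Qed.

(** The Koszul bracket of [xi] and [eta] corrected by [phi].  The function
    P(xi, eta) is written as the interior product of [sharp P xi] with [eta]. *)
Definition twisted_bracket (P : components M 2) (phi : components M 3)
    (xi eta : components M 1) : components M 1 := fun c u I =>
  interior_product (sharp P xi) (ext_d eta) c u I
  - interior_product (sharp P eta) (ext_d xi) c u I
  + ext_d (interior_product (sharp P xi) eta) c u I
  + interior_product (sharp P eta) (interior_product (sharp P xi) phi) c u I.

Lemma diff_form_twisted_bracket P phi xi eta :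
  multivector_field P -> diff_form phi -> diff_form xi -> diff_form eta ->
  diff_form (twisted_bracket P phi xi eta).
Proof.
move=> [sP aP cP] [sphi _ cphi] [sxi _ cxi] [seta _ ceta].
have sX := smooth_sharp sP sxi; have sY := smooth_sharp sP seta.
have cX := contravariant_sharp cP cxi; have cY := contravariant_sharp cP ceta.
have s1 := smooth_interior_product sX (smooth_ext_d seta).
have s2 := smooth_interior_product sY (smooth_ext_d sxi).
have s3 := smooth_ext_d (smooth_interior_product sX seta).
have s4 := smooth_interior_product sY (smooth_interior_product sX sphi).
have c1 := covariant_interior_product cX (covariant_ext_d1 seta ceta).
have c2 := covariant_interior_product cY (covariant_ext_d1 sxi cxi).
have c3 := covariant_ext_d0 (smooth_interior_product sX seta)
  (covariant_interior_product cX ceta).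
have c4 := covariant_interior_product cY (covariant_interior_product cX cphi).
split; [|exact: alternating1|].
  move=> c I; have oU := ccod_chart_open c.
  apply: (smoothD oU) (s4 c I); apply: (smoothD oU) (s3 c I).
  exact: (smoothB oU (s1 c I) (s2 c I)).
move=> c c' u uc I; rewrite /twisted_bracket (c1 _ _ _ uc) (c2 _ _ _ uc).
rewrite (c3 _ _ _ uc) (c4 _ _ _ uc) -sumrB -!big_split /=.
by apply: eq_bigr => J _; rewrite -mulrBr -!mulrDr.
Qed.

Lemma lie_bracket_sharp P phi xi eta :
  twisted_poisson P phi -> diff_form xi -> diff_form eta ->
  field_eq (lie_bracket (sharp P xi) (sharp P eta))
           (sharp P (twisted_bracket P phi xi eta)).
Proof.
move=> [[sP aP _] _ jac _] [sxi _ _] [seta _ _] c u uc K.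
have oU := ccod_chart_open c.
rewrite (tuple1_thead K); move: (thead K) => k {K}.
pose p i j := P c u [tuple i; j].
pose dp l i j := pderive l (fun v => P c v [tuple i; j]) u.
have pC i j : p i j = - p j i by exact: alternating2.
have dpC l i j : dp l i j = - dp l j i.
  rewrite /dp (pderive_eq_on l oU uc (fun v vc => alternating2 aP vc i j)).
  exact: deriveN (smooth_derivable (sP c _) uc).
have jacobi i j m := jac c u uc [tuple i; j; m].
have {}jacobi i j m := etrans (esym (half_schoutenE P c u i j m))
  (etrans (jacobi i j m) (ext_sharp3E P phi c u i j m)).
have sX := smooth_sharp sP sxi.
have key := @sharp_bracket_identity R n p dp
  (fun a b d => phi c u [tuple a; b; d])
  (fun i => xi c u [tuple i]) (fun i => eta c u [tuple i])
  (fun l i => pderive l (fun v => xi c v [tuple i]) u)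
  (fun l i => pderive l (fun v => eta c v [tuple i]) u)
  (fun l j => pderive l (fun v => sharp P xi c v [tuple j]) u)
  (fun l j => pderive l (fun v => sharp P eta c v [tuple j]) u)
  (fun j => sharp P xi c u [tuple j]) (fun j => sharp P eta c u [tuple j])
  pC dpC jacobi (fun=> erefl) (fun=> erefl)
  (fun l j => pderive_sharp l j sP sxi uc)
  (fun l j => pderive_sharp l j sP seta uc) k.
rewrite [LHS]key; apply: eq_bigr => m _; congr (_ * _).
rewrite /twisted_bracket; congr (_ - _ + _ + _).
- by apply: eq_bigr => l _; rewrite cons_tuple1 ext_d1E.
- by apply: eq_bigr => l _; rewrite cons_tuple1 ext_d1E.
- have dX l := smooth_derivable (i := m) (sX c [tuple l]) uc.
  have deta l := smooth_derivable (i := m) (seta c [tuple l]) uc.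
  rewrite ext_d0E.
  rewrite -[RHS]/(pderive m (fun v =>
    \sum_l sharp P xi c v [tuple l] * eta c v [tuple l]) u).
  rewrite pderive_sum => [|l]; last exact: derivableM (dX l) (deta l).
  by apply: eq_bigr => l _; rewrite pderiveM.
Qed.

End bracket.

Theorem proposition3 (R : realType) (n : nat) (M : smooth_manifold R n)
    (P : components M 2) (phi : components M 3) :
  twisted_poisson P phi -> foliated P.
Proof.
move=> tw X Y [xi fxi XE] [eta feta YE].
have [mP fphi _ _] := tw.
exists (twisted_bracket P phi xi eta); first exact: diff_form_twisted_bracket.
move=> c u uc I; rewrite (lie_bracket_eq XE YE)//.
exact: lie_bracket_sharp.
Qed.
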